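(* Let $I\in L^\infty(\Omega;\mathbb{R}^s)$ be a given image and let $\lambda>0$ be any parameter. Then there exists a minimizer of $$E(\mathbf{U},\mathbf{C})=\sum_{i=1}^N\left\{\int_\Omega\|\nabla u_i(x)\|\,dx+\lambda\int_\Omega |I(x)-c_i|\,u_i(x)\,dx\right\}$$ over $(\mathbf{U},\mathbf{C})\in\Delta\times\mathbb{R}^{sN}$; that is, there is $(\mathbf{U}^*,\mathbf{C}^* )\in\Delta\times\mathbb{R}^{sN}$ with $E(\mathbf{U}^*,\mathbf{C}^* )\le E(\mathbf{U},\mathbf{C})$ for all $(\mathbf{U},\mathbf{C})\in\Delta\times\mathbb{R}^{sN}$.
   Context: $\Omega\subset\mathbb{R}^2$ is a bounded open set with Lipschitz boundary; $N\ge 1$ is an integer (number of phases); $s\in\{1,3\}$ ($s=1$ for grayscale images, $s=3$ for color images). An image is a function $I:\Omega\to\mathbb{R}^s$. $BV(\Omega)$ is the space of real-valued functions of bounded variation on $\Omega$, and for $u\in BV(\Omega)$, $\int_\Omega\|\nabla u(x)\|\,dx$ denotes the (isotropic) total variation of $u$ on $\Omega$. The set of $N$-phase fuzzy membership functions is $$\Delta=\left\{(u_1,\dots,u_N)\ :\ u_i\in BV(\Omega),\ u_i(x)\ge 0,\ \sum_{i=1}^N u_i(x)=1\ \text{for (almost) all } x\in\Omega\right\}.$$ Notation: $\mathbf{U}=(u_1,\dots,u_N)$ and $\mathbf{C}=(c_1,\dots,c_N)\in\mathbb{R}^{sN}$ with each $c_i\in\mathbb{R}^s$. $|\cdot|$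 is a fixed norm on $\mathbb{R}^s$ (the absolute value if $s=1$). *)

(* Defs.v *)
From HB Require Import structures.
From mathcomp Require Export all_boot all_order all_algebra.
From mathcomp Require Export all_classical all_reals all_analysis.
Export Order.TTheory GRing.Theory Num.Theory.
Export numFieldNormedType.Exports.

Set Implicit Arguments.
Unset Strict Implicit.
Unset Printing Implicit Defensive.

Local Open Scope classical_set_scope.
Local Open Scope ring_scope.

(* R * R is measured through the sigma-algebra carried by lebesgue_measure:
   measurableTypeR R is R with its Borel sets, under another display. *)
Definition leb2 (R : realType) :
    {measure set (measurableTypeR R * measurableTypeR R) -> \bar R} :=
  (@lebesgue_measure R \x @lebesgue_measure R)%E.

(* The canonical norm on R * R is the max norm, hence this definition. *)
Definition enorm2 (R : realType) (v : R * R) : R :=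
  Num.sqrt (v.1 ^+ 2 + v.2 ^+ 2).

(* Around each boundary point p, in orthonormal coordinates (a, b) centred at p
   with axes e1, e2, the set Omega is the strict epigraph of a Lipschitz
   function inside an open square. The frame may be direct or indirect. *)
Definition lipschitz_boundary (R : realType) (Omega : set (R * R)) : Prop :=
  forall p : R * R, (closure Omega `\` interior Omega) p ->
  exists (e1 e2 : R * R) (g : R -> R) (r : R),
    [/\ [/\ enorm2 e1 = 1, enorm2 e2 = 1 & e1.1 * e2.1 + e1.2 * e2.2 = 0],
        lipschitz g,
        0 < r
      & forall a b : R, `|a| < r -> `|b| < r ->
          (Omega (p + a *: e1 + b *: e2) <-> g a < b)].

Definition C1 (R : realType) (f : R * R -> R) : Prop :=
  forall v : R * R, v = (1, 0) \/ v = (0, 1) ->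
    (forall x, derivable f x v) /\ continuous ('D_v f).

Definition divergence (R : realType) (phi : R * R -> R * R) (x : R * R) : R :=
  'D_((1, 0) : R * R) (fun y => (phi y).1) x
  + 'D_((0, 1) : R * R) (fun y => (phi y).2) x.

(* Fields in C^1_c(Omega; R^2) with Euclidean norm at most 1 everywhere; they
   are extended by 0 to the whole plane. *)
Definition test_field (R : realType) (Omega : set (R * R)) :
    set (R * R -> R * R) :=
  [set phi | [/\ C1 (fun x => (phi x).1), C1 (fun x => (phi x).2),
                 compact (closure [set x | phi x != 0]),
                 closure [set x | phi x != 0] `<=` Omega
               & forall x, enorm2 (phi x) <= 1]].

Definition total_variation2 (R : realType) (Omega : set (R * R))
    (u : R * R -> R) : \bar R :=
  ereal_sup [set (\int[leb2 R]_(x in Omega) (u x * divergence phi x)%:E)%E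
            | phi in test_field Omega].

(* Elements of function spaces on Omega are represented by total functions,
   whose values outside Omega are irrelevant. *)
Definition BV2 (R : realType) (Omega : set (R * R)) : set (R * R -> R) :=
  [set u | (leb2 R).-integrable Omega (EFin \o u)
         /\ (total_variation2 Omega u < +oo)%E].

Definition fuzzy_memberships (R : realType) (Omega : set (R * R)) (N : nat) :
    set ('I_N -> R * R -> R) :=
  [set U | [/\ forall i, BV2 Omega (U i),
               forall i, {ae leb2 R, forall x, Omega x -> 0 <= U i x}
             & {ae leb2 R, forall x, Omega x -> \sum_(i < N) U i x = 1}]].

Definition is_norm (R : realType) (s : nat) (nrm : 'rV[R]_s -> R) : Prop :=
  [/\ forall v, 0 <= nrm v,
      forall v, nrm v = 0 -> v = 0,
      forall (a : R) v, nrm (a *: v) = `|a| * nrm v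
    & forall v w, nrm (v + w) <= nrm v + nrm w].

(* L^oo(Omega; R^s). Measurability is componentwise, as row vectors carry no
   canonical sigma-algebra. *)
Definition Linfty (R : realType) (Omega : set (R * R)) (s : nat)
    (nrm : 'rV[R]_s -> R) : set (R * R -> 'rV[R]_s) :=
  [set I : R * R -> 'rV[R]_s | (forall j, measurable_fun
             (Omega : set (measurableTypeR R * measurableTypeR R))
             (fun x => I x 0 j))
         /\ exists M : R, {ae leb2 R, forall x, Omega x -> nrm (I x) <= M}].

Definition energy (R : realType) (Omega : set (R * R)) (s : nat)
    (nrm : 'rV[R]_s -> R) (I : R * R -> 'rV[R]_s) (lambda : R) (N : nat)
    (U : 'I_N -> R * R -> R) (C : 'I_N -> 'rV[R]_s) : \bar R :=
  (\sum_(i < N) (total_variation2 Omega (U i)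
    + lambda%:E * \int[leb2 R]_(x in Omega) (nrm (I x - C i) * U i x)%:E))%E.

(* Main.v *)
(** For fixed [C] the energy is a supremum of functionals that are linear in
    [U], hence convex in [U], so no compactness in BV is needed: among the
    memberships whose energy is within [1 / (n + 1)] of the infimum, take one of
    almost minimal L2 norm.  By the parallelogram identity these form a Cauchy
    sequence, a subsequence converges almost everywhere, and dominated
    convergence passes to the limit in every linear functional.  The infimum is
    finite because the divergence of a compactly supported field has zero
    integral (Fubini and the fundamental theorem of calculus).  The minimal
    energy is then a Lipschitz function of [C], and replacing each [c_i] of norm
    above [2 sup |I|] by [0] does not increase it, so that it attains its
      minimum
    on a product of compact balls. *)

Require Import Defs.
From mathcomp Require Import measurable_realfun lra.

Set Implicit Arguments.
Unset Strict Implicit.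
Unset Printing Implicit Defensive.

Local Open Scope classical_set_scope.
Local Open Scope ring_scope.

(** * Essentially bounded functions on a set of finite measure *)

Section ae_bounded.
Context d (T : measurableType d) (R : realType).
Variable mu : {measure set T -> \bar R}.
Variable D : set T.
Hypothesis mD : measurable D.
Hypothesis muD : (mu D < +oo)%E.

(** This is $L^\infty(D)$. As [mu D] is finite, its members are integrable, and its closure under
    sums and products settles the integrability conditions that arise later. *)
Definition ae_bounded (f : T -> R) :=
  measurable_fun D f /\
  exists M : R, {ae mu, forall x, D x -> `|f x| <= M}.

Lemma ae_bounded_integrable f : ae_bounded f -> mu.-integrable D (EFin \o f).
Proof.
move=> [mf [M fM]]; apply/integrableP; split; first exact/measurable_EFinP.
apply: (@le_lt_trans _ _ (\int[mu]_(x in D) (`|M|)%:E)%E); last first.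
  by rewrite integral_cst// lte_mul_pinfty// lee_fin.
apply: ae_ge0_le_integral => //.
- by do 2 apply: measurableT_comp => //.
- apply: filterS fM => x fM Dx; rewrite /= lee_fin.
  by rewrite (le_trans (fM Dx))// ler_norm.
Qed.

Lemma ae_bounded_cst (r : R) : ae_bounded (cst r).
Proof. by split=> //; exists `|r|; apply: aeW. Qed.

Lemma ae_boundedD f g : ae_bounded f -> ae_bounded g ->
  ae_bounded (fun x => f x + g x).
Proof.
move=> [mf [M fM]] [mg [P gP]]; split; first exact: measurable_funD.
exists (M + P); apply: filterS2 fM gP => x fM gP Dx.
by rewrite (le_trans (ler_normD _ _))// lerD ?fM ?gP.
Qed.

Lemma ae_boundedM f g : ae_bounded f -> ae_bounded g ->
  ae_bounded (fun x => f x * g x).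
Proof.
move=> [mf [M fM]] [mg [P gP]]; split; first exact: measurable_funM.
exists (M * P); apply: filterS2 fM gP => x fM gP Dx.
by rewrite normrM ler_pM ?fM ?gP.
Qed.

Lemma ae_boundedN f : ae_bounded f -> ae_bounded (fun x => - f x).
Proof.
move=> [mf [M fM]]; split; first exact: measurableT_comp.
by exists M; apply: filterS fM => x fM Dx; rewrite normrN fM.
Qed.

Lemma ae_boundedB f g : ae_bounded f -> ae_bounded g ->
  ae_bounded (fun x => f x - g x).
Proof. by move=> bf bg; exact: ae_boundedD bf (ae_boundedN bg). Qed.

Lemma ae_bounded_normr f : ae_bounded f -> ae_bounded (fun x => `|f x|).
Proof.
move=> [mf [M fM]]; split; first exact: measurableT_comp.
by exists M; apply: filterS fM => x fM Dx; rewrite normr_id fM.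
Qed.

Lemma ae_boundedX f n : ae_bounded f -> ae_bounded (fun x => f x ^+ n).
Proof.
move=> bf; elim: n => [|n IH]; first exact: ae_bounded_cst.
by under eq_fun do rewrite exprS; exact: ae_boundedM.
Qed.

(** The difference [g - f] agrees almost everywhere with its positive part, whose integral is
    nonnegative. *)
Lemma ae_le_Rintegral (f g : T -> R) : ae_bounded f -> ae_bounded g ->
  {ae mu, forall x, D x -> f x <= g x} ->
  \int[mu]_(x in D) f x <= \int[mu]_(x in D) g x.
Proof.
move=> bf bg fg; rewrite -subr_ge0 -RintegralB//;
  try exact: ae_bounded_integrable.
have bh := ae_boundedB bg bf.
rewrite /Rintegral (ae_eq_integral (fun x => (Num.max 0 (g x - f x))%:E))//.
- by apply: fine_ge0; apply: integral_ge0 => x _; rewrite lee_fin le_max lexx.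
- by case: bh => mh _; exact/measurable_EFinP.
- by apply/measurable_EFinP; apply: measurable_maxr => //; case: bh.
- by apply: filterS fg => x fg Dx; rewrite max_r// subr_ge0 fg.
Qed.

(** By monotone convergence the series of the [|f n.+1 x - f n x|] has a finite integral, hence a
    finite sum almost everywhere; there the telescoping series converges absolutely. *)
Lemma ae_cvg_of_summable_increments (f : nat -> T -> R) (c : R) :
  (forall n, ae_bounded (f n)) ->
  (forall n, \int[mu]_(x in D) `|f n.+1 x - f n x| <= c * 2^-1 ^+ n) ->
  {ae mu, forall x, D x -> cvgn (f ^~ x)}.
Proof.
move=> bf df.
pose g n x := `|f n.+1 x - f n x|.
have bg n : ae_bounded (g n) by apply/ae_bounded_normr/ae_boundedB.
have mg n : measurable_fun D (EFin \o g n).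
  by apply/measurable_EFinP; case: (bg n).
have mG : measurable_fun D (fun x => \sum_(0 <= n <oo) (g n x)%:E)%E.
  apply: (ge0_emeasurable_sum (P := xpredT)) => [n x Dx _|n _]; last exact: mg.
  by rewrite lee_fin normr_ge0.
have iG : mu.-integrable D (fun x => \sum_(0 <= n <oo) (g n x)%:E)%E.
  apply/integrableP; split => //.
  rewrite (eq_integral (fun x => \sum_(0 <= n <oo) (g n x)%:E)%E); last first.
    move=> x _; rewrite gee0_abs//; apply: nneseries_ge0 => n _ _.
    by rewrite lee_fin normr_ge0.
  rewrite integral_nneseries//; last by move=> n x _; rewrite lee_fin normr_ge0.
  have le1 n : (\int[mu]_(x in D) (g n x)%:E <= (c * 2^-1 ^+ n)%:E)%E.
    rewrite -[leLHS]fineK;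
      last exact: (integrable_fin_num _ (ae_bounded_integrable (bg n))).
    by rewrite lee_fin; exact: df.
  apply: (@le_lt_trans _ _ (\sum_(0 <= n <oo) (c * 2^-1 ^+ n)%:E)%E).
    apply: lee_nneseries => [n _ _|n _]; last exact: le1.
    by apply: integral_ge0 => x _; rewrite lee_fin normr_ge0.
  have h1 : `|2^-1 : R| < 1 by rewrite ger0_norm; lra.
  suff /cvg_lim -> : (fun n => \sum_(0 <= k < n) (c * 2^-1 ^+ k)%:E)%E @ \oo
      --> (c / (1 - 2^-1))%:E by [exact: ltry|].
  apply: cvg_EFin; first by apply: nearW => n; rewrite sumEFin.
  rewrite (_ : fine \o _ = series (geometric c 2^-1)).
    exact: cvg_geometric_series.
  by apply/funext => n /=; rewrite sumEFin.
have := integrable_ae mD iG; apply: filterS => x /[apply] Gx.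
have : cvgn (series (telescope (f ^~ x))).
  apply: normed_cvg; apply: nnseries_is_cvg => [n|]; first exact: normr_ge0.
  by rewrite -ge0_fin_numE//; apply: nneseries_ge0 => n _ _;
    rewrite lee_fin normr_ge0.
rewrite telescopeK => cv.
have -> : f ^~ x = (fun n => (f n x - f 0%N x) + f 0%N x).
  by apply/funext => n; rewrite subrK.
by apply: is_cvgD => //; exact: is_cvg_cst.
Qed.

End ae_bounded.

(** The infimum of [q] over [A n] increases with [n] and stays below [B], so it is almost constant
    from some index on. Two near-minimizers have a midpoint in the same set, whose [q] cannot be
    much smaller than theirs; the hypothesis on [dist], a parallelogram identity, then makes them
    close. *)
Lemma near_minimizers_cauchy (R : realType) (V : Type) (mid : V -> V -> V)
    (q : V -> R) (dist : V -> V -> R) (A : nat -> set V) (B : R)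
    (eps : nat -> R) :
  (forall n, A n !=set0) -> (forall n m, (n <= m)%N -> A m `<=` A n) ->
  (forall n u v, A n u -> A n v -> A n (mid u v)) ->
  (forall u, A 0%N u -> 0 <= q u <= B) ->
  (forall u v, A 0%N u -> A 0%N v ->
    dist u v = 2 * q u + 2 * q v - 4 * q (mid u v)) ->
  (forall n, 0 < eps n) -> (forall n, eps n.+1 <= eps n) ->
  exists v : nat -> V, forall n, A n (v n) /\ dist (v n) (v n.+1) <= eps n.
Proof.
move=> A0 Adecr Amid qB distE eps0 epsdecr.
pose a n := inf [set q u | u in A n].
have A0S n : A n `<=` A 0%N by exact: Adecr.
have hinf n : has_inf [set q u | u in A n].
  split; first by have [u Au] := A0 n; exists (q u), u.
  by exists 0 => _ [u /A0S/qB/andP[q0 _] <-].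
have a_le n u : A n u -> a n <= q u.
  by move=> Au; apply: ge_inf; [case: (hinf n)|exists u].
have a_decr n m : (n <= m)%N -> a n <= a m.
  move=> nm; apply: lb_le_inf; first by case: (hinf m).
  by move=> _ [u Au <-]; apply: a_le; exact: Adecr Au.
have hsup : has_sup (range a).
  split; first by exists (a 0%N), 0%N.
  exists B => _ [n _ <-]; have [u Au] := A0 n.
  by rewrite (le_trans (a_le _ _ Au))//; have /andP[] := qB _ (A0S _ _ Au).
set s := sup (range a).
have a_s n : a n <= s by apply: sup_ubound; [case: hsup|exists n].
(* With errors of [eps n / 8], the terms [2 * q u], [2 * q v] and [4 * q (mid u v)] of the distance
   contribute at most [eps n / 4], [eps n / 4] and [eps n / 2] once the multiples of [s] cancel. *)
have /choice[phi phiP] n : exists k, s - eps n / 8 < a k.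
  have e8 : 0 < eps n / 8 by rewrite divr_gt0.
  by have [_ [k _ <-] ak] := sup_adherent e8 hsup; exists k.
(* The partial sums make [psi] nondecreasing and at least [phi n], so that [v n] and [v n.+1] both
   lie in [A (psi n)]; the summand [n] puts [A (psi n)] inside [A n]. *)
pose psi n := (n + \sum_(i < n.+1) phi i)%N.
have psi_phi n : (phi n <= psi n)%N.
  by rewrite /psi big_ord_recr/= addnA leq_addl.
have psiS n : (psi n <= psi n.+1)%N.
  by rewrite /psi [in leqRHS]big_ord_recr/= addnA (leq_trans _ (leq_addr _
    _))// leq_add2r.
have psi_ge n : (n <= psi n)%N by rewrite /psi leq_addr.
have /choice[v vP] n : exists u, A (psi n) u /\ q u < a (psi n) + eps n / 8.
  have e8 : 0 < eps n / 8 by rewrite divr_gt0.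
  by have [_ [u Au <-] qu] := inf_adherent e8 (hinf (psi n)); exists u.
exists v => n; have [Avn qvn] := vP n; have [AvS qvS] := vP n.+1.
split; first exact: Adecr Avn.
rewrite distE; [|exact: A0S Avn|exact: A0S AvS].
have := a_le _ _ (Amid _ _ _ Avn (Adecr _ _ (psiS n) _ AvS)).
have := phiP n; have := a_decr _ _ (psi_phi n).
have := a_s (psi n); have := a_s (psi n.+1); have := epsdecr n.
lra.
Qed.

(** * The direct method for suprema of linear functionals of memberships *)

Section direct_method.
Context d (T : measurableType d) (R : realType).
Variable mu : {measure set T -> \bar R}.
Variable D : set T.
Hypothesis mD : measurable D.
Hypothesis muD : (mu D < +oo)%E.
Variable N : nat.
Implicit Types U V w : 'I_N -> T -> R.

(** Bounded variation is left out so that almost everywhere limits stay in the class; a finite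
    energy restores it in [memberships_fuzzy_memberships]. *)
Definition memberships U :=
  [/\ forall i, measurable_fun D (U i),
      forall i, {ae mu, forall x, D x -> 0 <= U i x}
    & {ae mu, forall x, D x -> \sum_(i < N) U i x = 1}].

Lemma memberships_le1 U : memberships U ->
  forall i, {ae mu, forall x, D x -> 0 <= U i x <= 1}.
Proof.
move=> [_ U0 U1] i.
have U0a : {ae mu, forall x i, D x -> 0 <= U i x} by exact: filter_forall.
apply: filterS2 U1 U0a => x U1 U0' Dx.
rewrite U0'//= -(U1 Dx) (bigD1 i)//= lerDl sumr_ge0// => j _.
exact: U0'.
Qed.

Lemma memberships_bounded U : memberships U ->
  forall i, ae_bounded mu D (U i).
Proof.
move=> UM i; split; first by case: UM.
exists 1; apply: filterS (memberships_le1 UM i) => x h Dx.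
by have /andP[U0 U1] := h Dx; rewrite ger0_norm.
Qed.

Definition midpoint U V : 'I_N -> T -> R := fun i x => 2^-1 * (U i x + V i x).

Lemma memberships_midpoint U V : memberships U -> memberships V ->
  memberships (midpoint U V).
Proof.
move=> [mU U0 U1] [mV V0 V1]; split.
- move=> i; apply: measurable_funM => //; exact: measurable_funD.
- move=> i; apply: filterS2 (U0 i) (V0 i) => x U0x V0x Dx.
  by rewrite /midpoint mulr_ge0// addr_ge0// ?U0x ?V0x.
- apply: filterS2 U1 V1 => x U1x V1x Dx.
  by rewrite /midpoint -mulr_sumr big_split/= U1x// V1x// -mulr2n mulVf.
Qed.

(** The $L^2$ inner product of [U] and [w]; the functionals to be minimized are suprema of such
    pairings. *)
Definition pairing U w : R := \sum_(i < N) \int[mu]_(x in D) (U i x * w i x).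

Lemma pairing_midpoint U V w : memberships U -> memberships V ->
  (forall i, ae_bounded mu D (w i)) ->
  pairing (midpoint U V) w = 2^-1 * (pairing U w + pairing V w).
Proof.
move=> UM VM bw; rewrite /pairing -big_split/= mulr_sumr.
apply: eq_bigr => i _; rewrite -RintegralD//; last 2 first.
- by apply: ae_bounded_integrable => //; apply: ae_boundedM => //;
    exact: memberships_bounded.
- by apply: ae_bounded_integrable => //; apply: ae_boundedM => //;
    exact: memberships_bounded.
rewrite -RintegralZl//; last first.
  by apply: ae_bounded_integrable => //; apply: ae_boundedD;
    apply: ae_boundedM => //;
    exact: memberships_bounded.
by apply: eq_Rintegral => x _; rewrite /midpoint; lra.
Qed.

Definition sqnorm U : R := \sum_(i < N) \int[mu]_(x in D) (U i x ^+ 2).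

Lemma sqnorm_bound U : memberships U -> 0 <= sqnorm U <= fine (mu D) *+ N.
Proof.
move=> UM; apply/andP; split.
  by apply: sumr_ge0 => i _; apply: Rintegral_ge0 => x _; exact: sqr_ge0.
rewrite -[in leRHS](card_ord N) -sumr_const; apply: ler_sum => i _.
rewrite -[leRHS]mul1r -Rintegral_cst//; apply: ae_le_Rintegral => //.
- by apply: ae_boundedX => //; exact: memberships_bounded.
- exact: ae_bounded_cst.
- apply: filterS (memberships_le1 UM i) => x h /h /andP[U0 U1].
  by rewrite expr_le1.
Qed.

(** The parallelogram identity holds pointwise and is integrated; it supplies the hypothesis on
    [dist] in [near_minimizers_cauchy]. *)
Lemma sqnormB U V : memberships U -> memberships V ->
  sqnorm (fun i x => U i x - V i x) =
  2 * sqnorm U + 2 * sqnorm V - 4 * sqnorm (midpoint U V).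
Proof.
move=> UM VM; rewrite /sqnorm !mulr_sumr -big_split/= -sumrB.
have bU i : ae_bounded mu D (fun x => U i x ^+ 2).
  by apply: ae_boundedX => //; exact: memberships_bounded.
have bV i : ae_bounded mu D (fun x => V i x ^+ 2).
  by apply: ae_boundedX => //; exact: memberships_bounded.
have bM i : ae_bounded mu D (fun x => midpoint U V i x ^+ 2).
  by apply: ae_boundedX => //; apply: memberships_bounded;
    exact: memberships_midpoint.
have b2 f r : ae_bounded mu D f -> ae_bounded mu D (fun x => r * f x).
  by apply: ae_boundedM; exact: ae_bounded_cst.
apply: eq_bigr => i _.
rewrite -!RintegralZl//; try exact: ae_bounded_integrable.
rewrite -RintegralD//; try by apply: ae_bounded_integrable => //; exact: b2.
rewrite -RintegralB//; last 2 first.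
- by apply: ae_bounded_integrable => //; apply: ae_boundedD => //; exact: b2.
- by apply: ae_bounded_integrable => //; exact: b2.
by apply: eq_Rintegral => x _; rewrite /midpoint !expr2; lra.
Qed.

(* AM-GM: [|g| <= (g ^ 2 / t + t) / 2] turns L2 estimates into L1 estimates. *)
Lemma Rintegral_normr_le_sqr (g : T -> R) (t : R) : ae_bounded mu D g -> 0 < t
  ->
  \int[mu]_(x in D) (g x ^+ 2) <= t ^+ 2 ->
  \int[mu]_(x in D) `|g x| <= (1 + fine (mu D)) / 2 * t.
Proof.
move=> bg t0 gt.
have bX : ae_bounded mu D (fun x => g x ^+ 2) by exact: ae_boundedX.
have b2 : ae_bounded mu D (fun x => (2 * t)^-1 * g x ^+ 2).
  by apply: ae_boundedM bX; exact: ae_bounded_cst.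
have b1 : ae_bounded mu D (fun=> t / 2) by exact: ae_bounded_cst.
apply: (@le_trans _ _ (\int[mu]_(x in D) ((2 * t)^-1 * g x ^+ 2 + t / 2))).
  apply: ae_le_Rintegral => //; [exact: ae_bounded_normr|exact: ae_boundedD|].
  apply: aeW => x _; rewrite -(ler_pM2l (_ : 0 < 2 * t)) ?mulr_gt0//.
  rewrite mulrDr mulrA mulfV ?mul1r; last by rewrite gt_eqF// mulr_gt0.
  rewrite -[in leRHS]real_normK ?num_real//.
  by have := sqr_ge0 (`|g x| - t); rewrite sqrrB; lra.
rewrite RintegralD//; try exact: ae_bounded_integrable.
rewrite (RintegralZl (f := fun x => g x ^+ 2))//;
  last exact: (ae_bounded_integrable mD muD bX).
rewrite Rintegral_cst//.
suff : (2 * t)^-1 * \int[mu]_(x in D) (g x ^+ 2) <= t / 2 by lra.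
rewrite ler_pdivrMl ?mulr_gt0//; apply: le_trans gt _.
by rewrite expr2; lra.
Qed.

(** Memberships take values in $[0,1]$, so an essential bound of [w i] dominates the products and
    dominated convergence applies. *)
Lemma pairing_cvg (v : nat -> 'I_N -> T -> R) U w :
  (forall n, memberships (v n)) -> (forall i, measurable_fun D (U i)) ->
  (forall i, ae_bounded mu D (w i)) ->
  (forall i, {ae mu, forall x, D x -> v ^~ i ^~ x @ \oo --> U i x}) ->
  (fun n => pairing (v n) w) @ \oo --> pairing U w.
Proof.
move=> vM mU bw vU; apply: cvg_big => [|i _]; first exact: add_continuous.
have [mw [M wM]] := bw i.
have := @dominated_convergence _ _ _ mu D mD
  (fun n x => (v n i x * w i x)%:E) (fun x => (U i x * w i x)%:E) (fun=> M%:E).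
case.
- move=> n; apply/measurable_EFinP; apply: measurable_funM => //.
  by case: (vM n).
- by apply/measurable_EFinP; exact: measurable_funM.
- apply: filterS (vU i) => x vUx Dx; apply: cvg_EFin.
    by apply: nearW.
  by apply: cvgM; [exact: vUx|exact: cvg_cst].
- by apply: (ae_bounded_integrable mD muD (ae_bounded_cst _ _ M)).
- have h n : {ae mu, forall x, D x -> 0 <= v n i x <= 1}.
    exact: memberships_le1.
  have /ae_foralln := h; apply: filterS2 wM => x wMx hx n Dx.
  rewrite lee_fin normrM -[leRHS]mul1r ler_pM ?wMx//.
  by have /andP[v0 v1] := hx n Dx; rewrite ger0_norm.
move=> iU _ vcvg; apply: fine_cvg; rewrite fineK//.
exact: (integrable_fin_num _ iU).
Qed.

(** The constraints are closed conditions at each point, and only countably many null sets are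
    discarded along the sequence. *)
Lemma memberships_cvg (v : nat -> 'I_N -> T -> R) U :
  (forall n, memberships (v n)) -> (forall i, measurable_fun D (U i)) ->
  (forall i, {ae mu, forall x, D x -> v ^~ i ^~ x @ \oo --> U i x}) ->
  memberships U.
Proof.
move=> vM mU vU; split => //.
- move=> i; have h n : {ae mu, forall x, D x -> 0 <= v n i x} by case: (vM n).
  have /ae_foralln := h; apply: filterS2 (vU i) => x vUx vx Dx.
  by apply: (ler_cvg_to (cvg_cst 0) (vUx Dx)); apply: nearW => n; exact: vx.
- have h n : {ae mu, forall x, D x -> \sum_(i < N) v n i x = 1} by case: (vM n).
  have /ae_foralln ha := h.
  have vUa : {ae mu, forall x i, D x -> v ^~ i ^~ x @ \oo --> U i x} by exact:
    filter_forall.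
  apply: filterS2 vUa ha => x vUx vx Dx.
  have : (fun n => \sum_(i < N) v n i x) @ \oo --> \sum_(i < N) U i x.
    apply: cvg_big => [|i _]; first exact: add_continuous.
    exact: vUx.
  rewrite (_ : (fun _ => _) = cst 1); last by apply/funext => n; rewrite vx.
  by move/cvg_lim => <-//; rewrite lim_cst.
Qed.

(** [S] collects the real numbers that bound $\sup_{w\in W}$ [pairing U w] for some [U], so [inf S]
    is the infimum of this convex functional. Sublevel sets are stable under midpoints, and each
    inequality for a fixed [w] passes to the almost everywhere limit. *)
Lemma pairing_minimizer (W : set ('I_N -> T -> R)) :
  (forall w, W w -> forall i, ae_bounded mu D (w i)) ->
  let S := [set e : R | exists2 U, memberships U & forall w, W w -> pairing U
    w <= e] in
  has_inf S ->
  exists2 U, memberships U & forall w, W w -> pairing U w <= inf S.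
Proof.
move=> bW S hS.
pose A n := [set U | memberships U /\ forall w, W w -> pairing U w <= inf S +
  n.+1%:R^-1].
(* Squared $L^2$ distances of at most [t n ^+ 2] become $L^1$ distances of order [t n], which are
   summable. *)
pose t n : R := 2^-1 ^+ n.
have t0 n : 0 < t n by exact: exprn_gt0.
have [v vP] : exists v : nat -> 'I_N -> T -> R, forall n, A n (v n) /\
    sqnorm (fun i x => v n i x - v n.+1 i x) <= t n ^+ 2.
  apply: (@near_minimizers_cauchy R _ midpoint sqnorm
    (fun U V => sqnorm (fun i x => U i x - V i x)) A (fine (mu D) *+ N)).
  - move=> n; have n0 : 0 < n.+1%:R^-1 :> R by rewrite invr_gt0.
    have [e [U UM Ue] eS] := inf_adherent n0 hS.
    by exists U; split => // w Ww; rewrite (le_trans (Ue w Ww))// ltW.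
  - move=> n m nm U [UM Um]; split => // w Ww; rewrite (le_trans (Um w Ww))//.
    by rewrite lerD2l lef_pV2 ?posrE// ler_nat.
  - move=> n U V [UM Un] [VM Vn]; split; first exact: memberships_midpoint.
    move=> w Ww; rewrite pairing_midpoint//; last exact: bW.
    by have := Un w Ww; have := Vn w Ww; move: (inf S + _) => c; lra.
  - by move=> U [UM _]; exact: sqnorm_bound.
  - by move=> U V [UM _] [VM _]; exact: sqnormB.
  - by move=> n; exact: exprn_gt0.
  - move=> n; rewrite /t -!exprM ler_wiXn2l//; [lra|].
    by rewrite leq_mul2r leqnSn.
have vM n : memberships (v n) by case: (vP n) => -[].
have cv i : {ae mu, forall x, D x -> cvgn (fun n => v n i x)}.
  apply: (@ae_cvg_of_summable_increments _ _ _ mu D mD muD _ ((1 + fine (mu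
    D)) / 2)).
    by move=> n; exact: memberships_bounded.
  move=> n; under eq_Rintegral do rewrite distrC.
  apply: (@Rintegral_normr_le_sqr (fun x => v n i x - v n.+1 i x)) => //.
    by apply: ae_boundedB => //; exact: memberships_bounded.
  have [_] := vP n; apply: le_trans.
  rewrite /sqnorm (bigD1 i)//= lerDl sumr_ge0// => j _.
  by apply: Rintegral_ge0 => x _; exact: sqr_ge0.
(* The upper limit is measurable even where the sequence diverges; [fine] turns infinite values into
   0, and inside [D] these occur on a null set only. *)
pose U i x := fine (limn_esup (fun n => (v n i x)%:E)).
have mU i : measurable_fun D (U i).
  apply: measurableT_comp => //; apply: measurable_fun_limn_esup => n.
  by apply/measurable_EFinP; case: (vM n).
have vU i : {ae mu, forall x, D x -> v ^~ i ^~ x @ \oo --> U i x}.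
  apply: filterS (cv i) => x cvx Dx.
  have h : (fun n => (v n i x)%:E) @ \oo --> (limn (fun n => v n i x))%:E.
    by apply: cvg_EFin; [exact: nearW|exact: cvx].
  rewrite /U is_cvg_limn_esupE; last by apply/cvg_ex; eexists; exact: h.
  by rewrite (cvg_lim _ h)//; exact: cvx.
exists U; first exact: memberships_cvg vM mU vU.
move=> w Ww; apply: (ler_cvg_to (pairing_cvg vM mU (bW w Ww) vU)
  (_ : (fun n => inf S + n.+1%:R^-1) @ \oo --> inf S)).
  by rewrite -[X in _ --> X]addr0; apply: cvgD;
    [exact: cvg_cst|exact: cvg_harmonic].
by apply: nearW => n; have [[_ +] _] := vP n; exact.
Qed.

End direct_method.

(** * Borel sets, compactly supported functions and Fubini in the plane *)

Section plane.
Context (R : realType).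
Notation mR := (measurableTypeR R).
Notation plane := (mR * mR)%type.
Implicit Types (D : set (R * R)) (f : R * R -> R).

Lemma measurable_itvR (i : interval R) : measurable ([set` i] : set mR).
Proof. exact: measurable_itv. Qed.

(** An open set is the union of the countably many boxes with rational centre and radius that it
    contains. *)
Lemma open_measurable_plane D : open D -> measurable (D : set plane).
Proof.
move=> oD.
pose box (q : rat * rat * rat) : set plane :=
  [set` `]ratr q.1.1 - ratr q.2, ratr q.1.1 + ratr q.2[%R] `*`
  [set` `]ratr q.1.2 - ratr q.2, ratr q.1.2 + ratr q.2[%R].
pose F q : set plane := if `[< box q `<=` D >] then box q else set0.
suff -> : D = \bigcup_q F q.
  apply: countable_bigcupT_measurable => [|q]; first exact: countableP.
  rewrite /F; case: ifP => _; last exact: measurable0.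
  by apply: measurableX; exact: measurable_itvR.
apply/seteqP; split => [p Dp|p [q _]]; last first.
  by rewrite /F; case: ifPn => // /asboolP; apply.
have := open_nbhs_nbhs (conj oD Dp) => /nbhs_ballP[e /= e0 eD].
(* With [r < e / 2] and a centre within [r] of [p], the box contains [p] and stays within [e] of
   it. *)
have [r] := @rat_in_itvoo R 0 (e / 2) (divr_gt0 e0 (ltr0n _ 2)).
rewrite in_itv/= => /andP[r0 re].
have rpos x : x - ratr r < x + ratr r :> R by lra.
have [q1] := rat_in_itvoo (rpos p.1); rewrite in_itv/= => /andP[q1l q1r].
have [q2] := rat_in_itvoo (rpos p.2); rewrite in_itv/= => /andP[q2l q2r].
exists (q1, q2, r) => //.
have bD : box (q1, q2, r) `<=` D.
  move=> y [/=]; rewrite !in_itv/= => /andP[y1l y1r] /andP[y2l y2r].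
  by apply: eD; split; rewrite /ball/= ltr_distlC; apply/andP; split; lra.
rewrite /F asboolT//; split => /=; rewrite in_itv/=; apply/andP; split; lra.
Qed.

Lemma continuous_measurable_plane f : continuous f ->
  measurable_fun (setT : set plane) f.
Proof.
move=> cf; apply: (measurability _ (RGenOInfty.measurableE R)) =>
  _ [_ [a ->] <-].
apply: measurableI => //; apply: open_measurable_plane.
by apply: open_comp; [move=> x _; exact: cf|exact: interval_open].
Qed.

Lemma leb2_square (M : R) : 0 <= M ->
  leb2 R ([set` `[- M, M]] `*` [set` `[- M, M]]) = ((M *+ 2) * (M *+ 2))%:E.
Proof.
move=> M0; pose A : set mR := [set` `[- M, M]].
transitivity (lebesgue_measure A * lebesgue_measure A)%E.
  by apply: product_measure1E; exact: measurable_itvR.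
rewrite !lebesgue_measure_itv/= lte_fin.
case: ltP => [_|MM]; first by rewrite opprK -EFinM mulr2n.
have -> : M = 0 by lra.
by rewrite mul0e mul0rn mul0r.
Qed.

Lemma bounded_leb2_lty D : open D -> bounded_set D -> (leb2 R D < +oo)%E.
Proof.
move=> oD /ex_strict_bound_gt0[M M0 DM].
have mA : measurable ([set` `[- M, M]] : set mR) by exact: measurable_itvR.
apply: (@le_lt_trans _ _ (leb2 R ([set` `[- M, M]] `*` [set` `[- M, M]]))).
  apply: le_measure; rewrite ?inE;
    [exact: open_measurable_plane|exact: measurableX|].
  move=> p /DM; rewrite /= prod_normE gt_max => /andP[p1 p2].
  by split; rewrite /= in_itv/= -ler_norml ltW.
by rewrite leb2_square ?ltry// ltW.
Qed.

Lemma derive_notin_support f v (K : set (R * R)) : closed K ->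
  (forall x, ~ K x -> f x = 0) -> forall x, ~ K x -> 'D_v f x = 0.
Proof.
move=> cK fK x Kx; rewrite -[RHS](derive_cst (0 : R) x v).
apply: near_eq_derive.
have : nbhs x (~` K) by apply: open_nbhs_nbhs; split => //; exact: closed_openC.
by apply: filterS => y /fK.
Qed.

Lemma compact_square (A : R) :
  compact ([set` `[- A, A]] `*` [set` `[- A, A]] : set (R * R)).
Proof. by apply: compact_setX; exact: segment_compact. Qed.

Lemma square_norm (A : R) (x : R * R) :
  ([set` `[- A, A]] `*` [set` `[- A, A]] : set (R * R)) x = (`|x| <= A) :> Prop.
Proof.
apply/propext; rewrite prod_normE ge_max !ler_norml;
  split=> [xA|/andP[xA1 xA2]].
  by case: xA; rewrite /= !in_itv/= => xA1 xA2; exact/andP.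
by split; rewrite /= in_itv/=.
Qed.

Lemma continuous_supp_bounded f (A : R) : continuous f ->
  (forall x, A < `|x| -> f x = 0) -> exists M, forall x, `|f x| <= M.
Proof.
move=> cf fA.
have /compact_bounded/ex_strict_bound_gt0[M M0 fM] : compact (f @` ([set` `[-
  A, A]] `*` [set` `[- A, A]])).
  by apply: continuous_compact;
    [exact: continuous_subspaceT|exact: compact_square].
exists M => x; have [xA|/fA->] := leP `|x| A; last by rewrite normr0 ltW.
by rewrite ltW//; apply: fM; exists x => //; rewrite square_norm.
Qed.

Lemma continuous_supp_integrable f (A : R) : 0 <= A -> continuous f ->
  (forall x, A < `|x| -> f x = 0) -> (leb2 R).-integrable setT (EFin \o f).
Proof.
move=> A0 cf fA.
have [M fM] := continuous_supp_bounded cf fA.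
pose Q : set plane := [set` `[- A, A]] `*` [set` `[- A, A]].
have mQ : measurable Q by apply: measurableX; exact: measurable_itvR.
rewrite (_ : EFin \o f = (EFin \o f) \_ Q); last first.
  apply/funext => x; rewrite patchE; case: ifPn => // /negP xQ /=.
  rewrite fA// ltNge; apply/negP => xA; apply: xQ; rewrite inE.
  by rewrite -(square_norm A x) in xA.
apply/(integrable_mkcond _ mQ); apply: ae_bounded_integrable => //.
  by rewrite leb2_square// ltry.
split; last by exists M; exact: aeW.
by apply: measurable_funTS; exact: continuous_measurable_plane.
Qed.

(** The fundamental theorem of calculus gives [F A - F (- A)]; the weak inequality in the hypothesis
    on [F] makes both endpoint values vanish. *)
Lemma integral_derivative_supp (F f : R -> R) (A : R) : 0 < A ->
  (forall x : R, is_derive x (1 : R) F (f x)) -> continuous f ->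
  (forall x, A <= `|x| -> F x = 0) -> (forall x, A < `|x| -> f x = 0) ->
  (\int[@lebesgue_measure R]_x (f x)%:E = 0)%E.
Proof.
move=> A0 dF cf FA fA.
have cF : continuous F.
  move=> x; apply: differentiable_continuous; apply/derivable1_diffP.
  by have := dF x; case.
transitivity (\int[@lebesgue_measure R]_(x in `[(- A)%R, A]) (f x)%:E)%E.
  rewrite [RHS]integral_mkcond; apply: eq_integral => x _.
  rewrite patchE; case: ifPn => // /negP xA; rewrite fA// ltNge;
    apply/negP => xA'.
  by apply: xA; rewrite inE/= in_itv/= -ler_norml.
rewrite (@continuous_FTC2 _ f F).
- by rewrite !FA ?normrN ?gtr0_norm// subee.
- lra.
- exact: continuous_subspaceT.
- split=> [x _||]; first by have := dF x; case.
  + by apply: cvg_at_right_filter; exact: cF.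
  + by apply: cvg_at_left_filter; exact: cF.
- by move=> x _; rewrite derive1E; apply: derive_val.
Qed.

(** Both derivatives are limits of the same difference quotient; this reduces partial derivatives to
    calculus in one variable. *)
Lemma is_derive_slice (f : R * R -> R) (v x : R * R) (t : R) :
  derivable f (x + t *: v) v ->
  is_derive t (1 : R) (fun s => f (x + s *: v)) ('D_v f (x + t *: v)).
Proof.
move=> df.
have E : (fun h : R => h^-1 *: ((fun s =>
  f (x + s *: v)) (h *: 1 + t) - f (x + t *: v)))
    = (fun h : R => h^-1 *: (f (h *: v + (x + t *: v)) - f (x + t *: v))).
  apply/funext => h; congr (_ *: (f _ - _)).
  by rewrite scalerDl [h *: 1]mulr1 addrCA.
split; first by rewrite /derivable E.
by rewrite /derive E.
Qed.

(** The inequality becomes strict because [f] need not vanish on a neighbourhood of a point of norm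
    [A]. *)
Lemma derive_supp_norm f v (A : R) : (forall x, A <= `|x| -> f x = 0) ->
  forall x, A < `|x| -> 'D_v f x = 0.
Proof.
move=> fA x Ax.
have cK : closed [set y : R * R | `|y| <= A].
  by apply: (@closed_comp _ _ _ [set y : R | y <= A]) => [y _|];
    [exact: norm_continuous|exact: closed_le].
apply: (derive_notin_support v cK); last by rewrite /=; apply/negP;
  rewrite -ltNge.
by move=> y /negP; rewrite /= -ltNge => /ltW/fA.
Qed.

(** By Fubini one integrates along the direction [v] first; the inner integral is that of a
    one-variable derivative with bounded support, hence 0. *)
Lemma integral_partial_derivative_supp f (v : R * R) (A : R) :
  v = (1, 0) \/ v = (0, 1) -> 0 < A ->
  C1 f -> (forall x, A <= `|x| -> f x = 0) ->
  (\int[leb2 R]_x ('D_v f x)%:E = 0)%E.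
Proof.
move=> v01 A0 /(_ v v01)[df cDf] fA.
have DfA : forall x, A < `|x| -> 'D_v f x = 0 by exact: derive_supp_norm.
have iD := continuous_supp_integrable (ltW A0) cDf DfA.
have norm_l (x y : R) : `|x| <= `|(x, y)| by rewrite prod_normE le_max lexx.
have norm_r (x y : R) : `|y| <= `|(x, y)| by rewrite prod_normE le_max lexx
  orbT.
case: v01 => vE.
- rewrite -(integral21_prod_meas1 iD); apply: integral0_eq => y _.
  (* The slice is the line through [(0, y)] with direction [v], the form that [is_derive_slice]
     takes. *)
  have E (t : R) : (t, y) = (0, y) + t *: v by rewrite vE
    [RHS]surjective_pairing/= [t *: 1]mulr1 scaler0 add0r addr0.
  apply: (@integral_derivative_supp (fun t => f (t, y)) (fun t =>
    'D_v f (t, y)) A) => //.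
  + move=> t; rewrite E; have := @is_derive_slice f v (0, y) t (df _).
    by under eq_fun do rewrite -E.
  + move=> t; apply: (@continuous_comp R (R * R)%type R (fun t =>
    (t, y)) ('D_v f)); last exact: cDf.
    by apply: (@cvg_pair _ _ _ (nbhs t) (nbhs t) (nbhs y));
      [exact: cvg_id|exact: cvg_cst].
  + by move=> t At; rewrite fA// (le_trans At).
  + by move=> t At; rewrite DfA// (lt_le_trans At).
- rewrite -(integral12_prod_meas1 iD); apply: integral0_eq => y _.
  have E (t : R) : (y, t) = (y, 0) + t *: v by rewrite vE
    [RHS]surjective_pairing/= [t *: 1]mulr1 scaler0 add0r addr0.
  apply: (@integral_derivative_supp (fun t => f (y, t)) (fun t =>
    'D_v f (y, t)) A) => //.
  + move=> t; rewrite E; have := @is_derive_slice f v (y, 0) t (df _).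
    by under eq_fun do rewrite -E.
  + move=> t; apply: (@continuous_comp R (R * R)%type R (fun t =>
    (y, t)) ('D_v f)); last exact: cDf.
    by apply: (@cvg_pair _ _ _ (nbhs t) (nbhs y) (nbhs t));
      [exact: cvg_cst|exact: cvg_id].
  + by move=> t At; rewrite fA// (le_trans At).
  + by move=> t At; rewrite DfA// (lt_le_trans At).
Qed.

End plane.

(** * Test fields and their divergence *)

Section test_fields.
Context (R : realType) (Omega : set (R * R)).
Implicit Types phi : R * R -> R * R.

Lemma test_field0 : test_field Omega (cst 0).
Proof.
have C1cst : C1 (fun _ : R * R => 0 : R).
  move=> v _; split=> [x|]; first exact: derivable_cst.
  rewrite (_ : 'D_v _ = cst 0); first by move=> x; exact: cvg_cst.
  by apply/funext => x; rewrite derive_cst.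
have supp0 : [set x : R * R | (cst 0 x : R * R) != 0] = set0.
  by apply/seteqP; split => x //=; rewrite eqxx.
split => //.
- by rewrite supp0 closure0; exact: compact0.
- by rewrite supp0 closure0; exact: sub0set.
- by move=> x; rewrite /enorm2/= expr0n addr0 sqrtr0.
Qed.

Lemma divergence0 (x : R * R) : divergence (cst 0) x = 0 :> R.
Proof. by rewrite /divergence !derive_cst addr0. Qed.

Lemma test_field_supp phi x : ~ closure [set x | phi x != 0] x -> phi x = 0.
Proof. by move=> h; apply: contrapT => /eqP px; apply: h;
  exact: subset_closure. Qed.

Lemma test_field_bounded_supp phi : test_field Omega phi ->
  exists2 A : R, 0 < A & forall x, A <= `|x| -> ~ closure [set x | phi x != 0]
    x.
Proof.
move=> [_ _ /compact_bounded/ex_strict_bound_gt0[A A0 KA] _ _].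
by exists A => // x Ax /KA /=; rewrite ltNge Ax.
Qed.

Lemma divergence_notin phi x : ~ closure [set x | phi x != 0] x ->
  divergence phi x = 0.
Proof.
move=> Kx; have cK := @closed_closure _ [set x | phi x != 0].
rewrite /divergence (derive_notin_support _ cK _ Kx); last first.
  by move=> y /test_field_supp ->.
rewrite (derive_notin_support _ cK _ Kx) ?addr0//.
by move=> y /test_field_supp ->.
Qed.

Lemma divergence_continuous phi : test_field Omega phi ->
  continuous (divergence phi).
Proof.
move=> [C1l C1r _ _ _] x; rewrite /divergence; apply: cvgD.
- by have [_] := C1l _ (or_introl erefl); exact.
- by have [_] := C1r _ (or_intror erefl); exact.
Qed.

Lemma divergence_ae_bounded phi : test_field Omega phi ->
  ae_bounded (leb2 R) Omega (divergence phi).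
Proof.
move=> tf; have cd := divergence_continuous tf; split.
  by apply: measurable_funTS; exact: continuous_measurable_plane.
have [A A0 KA] := test_field_bounded_supp tf.
have [M dM] := @continuous_supp_bounded _ _ A cd
  (fun x Ax => divergence_notin (KA x (ltW Ax))).
by exists M; exact: aeW.
Qed.

(** The support lies in [Omega], so the integral extends to the whole plane, where each partial
    derivative has integral 0. This is what gives constant memberships a finite energy. *)
Lemma Rintegral_divergence phi : test_field Omega phi ->
  \int[leb2 R]_(x in Omega) divergence phi x = 0.
Proof.
move=> tf; have [C1l C1r _ KO _] := tf.
have [A A0 KA] := test_field_bounded_supp tf.
rewrite Rintegral_mkcond (_ : _ \_ _ = divergence phi); last first.
  apply/funext => x; rewrite patchE; case: ifPn => // /negP xO.
  by rewrite divergence_notin// => /KO xO'; apply: xO; rewrite inE.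
have iD (f : R * R -> R) v : v = (1, 0) \/ v = (0, 1) -> C1 f ->
    (forall x, A <= `|x| -> f x = 0) ->
    (leb2 R).-integrable setT (EFin \o 'D_v f).
  move=> v01 C1f fA; have [_ cD] := C1f _ v01.
  apply: (continuous_supp_integrable (ltW A0) cD) => x Ax.
  exact: derive_supp_norm fA _ Ax.
have z1 x : A <= `|x| -> (phi x).1 = 0 by move=> /KA/test_field_supp ->.
have z2 x : A <= `|x| -> (phi x).2 = 0 by move=> /KA/test_field_supp ->.
have v1 : (1, 0) = (1, 0) :> R * R \/ (1, 0) = (0, 1) :> R * R by left.
have v2 : (0, 1) = (1, 0) :> R * R \/ (0, 1) = (0, 1) :> R * R by right.
rewrite RintegralD//; last 2 first.
- exact: iD v1 C1l z1.
- exact: iD v2 C1r z2.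
rewrite /Rintegral (integral_partial_derivative_supp v1 A0 C1l z1).
by rewrite (integral_partial_derivative_supp v2 A0 C1r z2) addr0.
Qed.

End test_fields.

(** The choices [phi i] are independent of each other, so the sum of the suprema is the supremum of
    the sums. *)
Lemma sum_ereal_sup_leP (R : realType) (n : nat) (J : Type) (P : set J)
    (s : 'I_n -> J -> R) (b : 'I_n -> R) (e : R) : P !=set0 ->
  (\sum_(i < n) (ereal_sup [set (s i j)%:E | j in P] + (b i)%:E) <= e%:E)%E <->
  (forall phi : 'I_n -> J, (forall i, P (phi i)) ->
    \sum_(i < n) (s i (phi i) + b i) <= e).
Proof.
move=> [j0 Pj0]; split=> [le_e phi Pphi|le_e].
  rewrite -lee_fin -sumEFin; apply: le_trans le_e; apply: lee_sum => i _.
  by rewrite EFinD leeD2r//; apply: ereal_sup_ubound; exists (phi i).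
(* Finiteness comes first, to allow real arithmetic: the choice at [i] varies while the others are
   frozen at [j0], and [c] is what [e] leaves for the varying term. *)
have sup_fin i : ereal_sup [set (s i j)%:E | j in P] \is a fin_num.
  apply/fin_real/andP; split.
    by apply: (@lt_le_trans _ _ (s i j0)%:E);
      [exact: ltNyr|apply: ereal_sup_ubound; exists j0].
  pose c := e - (\sum_(k < n | k != i) (s k j0 + b k) + b i).
  apply: (@le_lt_trans _ _ c%:E); last exact: ltry.
  apply: ge_ereal_sup => _ [j Pj <-]; rewrite lee_fin /c lerBrDr.
  have := le_e (fun k => if k == i then j else j0).
  rewrite (bigD1 i)//= eqxx (eq_bigr (fun k => s k j0 + b k)); last first.
    by move=> k /negbTE ->.
  rewrite -addrA [b i + _]addrC; apply => k.
  by case: ifP.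
pose a i := fine (ereal_sup [set (s i j)%:E | j in P]).
rewrite (eq_bigr (fun i => (a i + b i)%:E)); last first.
  by move=> i _; rewrite EFinD /a fineK.
rewrite sumEFin lee_fin; apply/ler_addgt0Pr => eps eps0.
(* Dividing by [n.+1] covers the case where [n] is 0, and the [n] errors still add up to at most
   [eps]. *)
have d0 : 0 < eps / n.+1%:R by rewrite divr_gt0.
have /choice[phi phiP] i : exists j, P j /\ a i - eps / n.+1%:R < s i j.
  have : ((a i - eps / n.+1%:R)%:E < ereal_sup [set (s i j)%:E | j in P])%E.
    by rewrite -[ltRHS]fineK// lte_fin ltrBlDr ltrDl.
  by move=> /ereal_sup_gt[_ [j Pj <-]]; rewrite lte_fin; exists j.
apply: (@le_trans _ _ (\sum_(i < n) (s i (phi i) + b i + eps / n.+1%:R))).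
  by apply: ler_sum => i _; have [_] := phiP i; move: (eps / _) => c h; lra.
rewrite big_split/= lerD//; first by apply: le_e => i; case: (phiP i).
rewrite sumr_const card_ord -[leLHS]mulr_natr mulrAC ler_pdivrMr// ler_pM2l//.
by rewrite ler_nat.
Qed.

(** * Arbitrary norms on row vectors *)

Section norms.
Context (R : realType) (s : nat) (nrm : 'rV[R]_s -> R).
Hypothesis nrm_norm : is_norm nrm.
Implicit Types v w : 'rV[R]_s.

Lemma nrm_ge0 v : 0 <= nrm v. Proof. by case: nrm_norm => + _ _ _; exact. Qed.

Lemma nrmD v w : nrm (v + w) <= nrm v + nrm w.
Proof. by case: nrm_norm => _ _ _; exact. Qed.

Lemma nrmZ a v : nrm (a *: v) = `|a| * nrm v.
Proof. by case: nrm_norm => _ _ + _; exact. Qed.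

Lemma nrm0 : nrm 0 = 0.
Proof. by rewrite -(scale0r 0) nrmZ normr0 mul0r. Qed.

Lemma nrmN v : nrm (- v) = nrm v.
Proof. by rewrite -scaleN1r nrmZ normrN1 mul1r. Qed.

Lemma nrm_distC v w : nrm (v - w) = nrm (w - v).
Proof. by rewrite -opprB nrmN. Qed.

Lemma nrm_coord v : nrm v <= \sum_(j < s) `|v 0 j| * nrm (delta_mx 0 j).
Proof.
rewrite [in leLHS](row_sum_delta v).
elim/big_ind2 : _ => [|x a y b xa yb|j _]; first by rewrite nrm0.
- by rewrite (le_trans (nrmD _ _))// lerD.
- by rewrite nrmZ.
Qed.

Lemma nrm_le_norm : exists2 L : R, 0 < L & forall v, nrm v <= L * `|v|.
Proof.
(* The summand 1 keeps the constant positive in dimension 0 too, so that [nrm_continuous] can divide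
   by it. *)
exists (1 + \sum_(j < s) nrm (delta_mx 0 j)).
  by rewrite ltr_pwDl// sumr_ge0// => j _; exact: nrm_ge0.
move=> v; rewrite (le_trans (nrm_coord v))// mulrDl mul1r mulr_suml ler_wpDl//.
apply: ler_sum => j _; rewrite mulrC ler_wpM2l ?nrm_ge0//.
rewrite [leRHS]/Num.Def.normr/= mx_normrE.
by apply: (le_bigmax _ (fun ij => `|v ij.1 ij.2|) (0, j)).
Qed.

Lemma nrm_dist v w : `|nrm v - nrm w| <= nrm (v - w).
Proof.
have h1 := nrmD (v - w) w; have h2 := nrmD (w - v) v.
rewrite !subrK nrm_distC in h1 h2; rewrite -nrm_distC in h2.
rewrite ler_norml; apply/andP; split; rewrite nrm_distC in h1 *; lra.
Qed.

Lemma nrm_continuous : continuous nrm.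
Proof.
have [L L0 nL] := nrm_le_norm.
move=> v; apply/(@cvgrPdist_lt _ _ _ (nbhs v)) => e e0; near=> w.
rewrite (le_lt_trans (nrm_dist v w))// (le_lt_trans (nL _))//.
rewrite mulrC -ltr_pdivlMr//.
near: w; apply: (@cvgr_dist_lt _ _ _ (nbhs v) _ id v); first exact: cvg_id.
by rewrite divr_gt0.
Unshelve. all: by end_near. Qed.

(** Equivalence of norms: [nrm] has a positive minimum on the unit sphere of the max norm, so the
    ball is bounded for the max norm; it is closed by continuity. *)
Lemma nrm_ball_compact (r : R) : compact [set v | nrm v <= r].
Proof.
have cl : closed [set v | nrm v <= r].
  by apply: (@closed_comp _ _ nrm [set y : R | y <= r]) => [v _|];
    [exact: nrm_continuous|exact: closed_le].
apply: bounded_closed_compact cl.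
pose S := [set v : 'rV[R]_s | `|v| = 1].
(* If the sphere is empty, as in dimension 0, then 0 is the only vector. *)
have [[v0 Sv0]|S0] := pselect (S !=set0); last first.
  exists 0; split; first exact: num_real.
  move=> M M0 v _ /=; have [->|v0] := eqVneq v 0; first by rewrite normr0 ltW.
  exfalso; apply: S0; exists (`|v|^-1 *: v) => /=.
  by rewrite /S/= normrZ normfV normr_id mulVf// normr_eq0.
have cS : compact S.
  apply: bounded_closed_compact.
    by exists 1; split; [exact: num_real|move=> M M1 v /= ->; exact: ltW].
  by apply: (@closed_comp _ _ (fun v : 'rV[R]_s =>
    `|v|) [set y : R | y = 1]) => [v _|];
    [exact: norm_continuous|exact: closed_eq].
have [w /[!inE] Sw wmin] : exists2 c, c \in S & forall t, t \in S -> nrm c <=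
  nrm t.
  apply: EVT_min_rV => //; first by exists v0.
  by apply: continuous_subspaceT; exact: nrm_continuous.
have nw : 0 < nrm w.
  rewrite lt_neqAle nrm_ge0 andbT eq_sym;
    apply/eqP => /(let: And4 _ h _ _ := nrm_norm in h) w0.
  by move: Sw; rewrite /S/= w0 normr0 => /eqP; rewrite eq_sym oner_eq0.
exists (r / nrm w); split; first exact: num_real.
move=> M rM v /= vr; rewrite (le_trans _ (ltW rM))// ler_pdivlMr//.
apply: le_trans vr.
have [->|v0'] := eqVneq v 0; first by rewrite normr0 mul0r nrm_ge0.
have nv : 0 < `|v| by rewrite normr_gt0.
have : nrm w <= nrm (`|v|^-1 *: v).
  by apply: wmin; rewrite inE /S/= normrZ normfV normr_id mulVf// gt_eqF.
by rewrite nrmZ normfV normr_id ler_pdivlMl.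
Qed.

(* Density of the rational vectors writes [nrm v < a] as a countable union of
   conditions on the coordinates of [v]. *)
Lemma measurable_nrm d (T : measurableType d) (D : set T) (f : T -> 'rV[R]_s) :
  (forall j, measurable_fun D (fun x => f x 0 j)) ->
  measurable_fun D (fun x => nrm (f x)).
Proof.
move=> mf mD; apply: (measurability _ (RGenInftyO.measurableE R)) =>
  // _ [_ [a ->] <-].
pose q2v (q : 'rV[rat]_s) : 'rV[R]_s := map_mx ratr q.
pose g q x := nrm (q2v q) + \sum_(j < s) `|f x 0 j - q2v q 0 j| * nrm
  (delta_mx 0 j).
have mg q : measurable_fun D (g q).
  apply: measurable_funD => //; apply: measurable_sum => j.
  by apply: measurable_funM => //; apply: measurableT_comp => //;
    exact: measurable_funB.
rewrite (_ : _ `&` _ = \bigcup_q (D `&` g q @^-1` `]-oo, a[)).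
  apply: countable_bigcupT_measurable => [|q]; first exact: countableP.
  by apply: mg => //; exact: measurable_itv.
apply/seteqP; split => [x [Dx]|x [q _ [Dx]]]; rewrite /= in_itv/=; last first.
  move=> gq; split => //; rewrite in_itv/=; apply: le_lt_trans gq.
  rewrite /g -[in leLHS](subrKC (q2v q) (f x)) (le_trans (nrmD _ _))// lerD2l.
  apply: le_trans (nrm_coord _) _; apply: ler_sum => j _.
  by rewrite !mxE.
move=> na.
pose L := 1 + \sum_(j < s) nrm (delta_mx 0 j).
have L0 : 0 < L by rewrite ltr_pwDl// sumr_ge0// => j _; exact: nrm_ge0.
(* The two approximation errors in [g] are at most [e * (L - 1)] each, and [2 * (e * L)] is the
   whole gap [a - nrm (f x)]. *)
pose e := (a - nrm (f x)) / (2 * L).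
have e0 : 0 < e by rewrite divr_gt0 ?mulr_gt0// subr_gt0.
have /choice[q qP] j : exists q : rat, `|f x 0 j - ratr q| < e.
  have [q] : exists q : rat, ratr q \in `]f x 0 j - e, f x 0 j + e[ by apply:
    rat_in_itvoo; lra.
  by rewrite in_itv/= => /andP[q1 q2]; exists q; rewrite ltr_distlC; apply/andP.
exists (\row_j q j) => //; split => //; rewrite /= in_itv/=.
have sum_le : \sum_(j < s) `|f x 0 j - q2v (\row_j q j) 0 j| * nrm (delta_mx 0
  j) <= e * (L - 1).
  rewrite /L addrAC subrr add0r mulr_sumr; apply: ler_sum => j _.
  by rewrite ler_wpM2r ?nrm_ge0// !mxE ltW.
have n_le : nrm (q2v (\row_j q j)) <= nrm (f x) + e * (L - 1).
  have := nrm_dist (q2v (\row_j q j)) (f x); rewrite ler_norml => /andP[_ h].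
  have h2 := nrm_coord (f x - q2v (\row_j q j)).
  rewrite nrm_distC in h.
  have : nrm (f x - q2v (\row_j q j)) <= e * (L - 1).
    apply: le_trans h2 (le_trans _ sum_le); apply: ler_sum => j _.
    by rewrite !mxE.
  lra.
rewrite /g; have : e * L = (a - nrm (f x)) / 2.
  by rewrite /e invfM mulrA -mulrA mulVf ?mulr1// gt_eqF.
nra.
Qed.

End norms.

(** As [U i] lies in $[0,1]$, raising a weight by the constant [c i] costs at most [c i] times the
    measure of [D]. *)
Lemma pairing_le d (T : measurableType d) (R : realType)
    (mu : {measure set T -> \bar R}) (D : set T) (N : nat)
    (U w w' : 'I_N -> T -> R) (c : 'I_N -> R) :
  measurable D -> (mu D < +oo)%E -> memberships mu D U ->
  (forall i, ae_bounded mu D (w i)) -> (forall i, ae_bounded mu D (w' i)) ->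
  (forall i, 0 <= c i) ->
  (forall i, {ae mu, forall x, D x -> w i x <= w' i x + c i}) ->
  pairing mu D U w <= pairing mu D U w' + fine (mu D) * \sum_(i < N) c i.
Proof.
move=> mD muD UM bw bw' c0 ww'; rewrite /pairing mulr_sumr -big_split/=.
apply: ler_sum => i _; have bU := memberships_bounded UM i.
have bUw' : ae_bounded mu D (fun x => U i x * w' i x) by exact: ae_boundedM.
rewrite [fine _ * _]mulrC -Rintegral_cst// -RintegralD//; last 2 first.
- exact: ae_bounded_integrable.
- by apply: ae_bounded_integrable => //; exact: ae_bounded_cst.
apply: ae_le_Rintegral => //; first exact: ae_boundedM.
  by apply: ae_boundedD => //; exact: ae_bounded_cst.
apply: filterS2 (ww' i) (memberships_le1 UM i) => x wx Ux Dx.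
have /andP[U0 U1] := Ux Dx; have {}wx := wx Dx.
rewrite (le_trans (ler_wpM2l U0 wx))// mulrDr lerD2l.
by rewrite -[leRHS]mul1r ler_wpM2r.
Qed.

(** * Minimization of the energy in [U] for fixed [C], then in [C] *)

Section existence.
Context (R : realType) (Omega : set (R * R)).
Hypothesis Omega_open : open Omega.
Hypothesis Omega_bounded : bounded_set Omega.
Context (N s : nat) (nrm : 'rV[R]_s -> R).
Hypothesis nrm_norm : is_norm nrm.
Variables (I : R * R -> 'rV[R]_s) (lambda : R).
Hypothesis I_Linfty : Linfty Omega nrm I.
Hypothesis lambda_gt0 : 0 < lambda.
Notation mR := (measurableTypeR R).
Notation plane := (mR * mR)%type.
Notation mu := (leb2 R).
Notation E := (energy Omega nrm I lambda).
Implicit Types (U : 'I_N -> R * R -> R) (C : 'I_N -> 'rV[R]_s).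
Implicit Types phi : 'I_N -> R * R -> R * R.

Let mO : measurable (Omega : set plane).
Proof. exact: open_measurable_plane. Qed.

Let muO : (mu Omega < +oo)%E.
Proof. exact: bounded_leb2_lty. Qed.

Definition fidelity (c : 'rV[R]_s) (x : R * R) : R := lambda * nrm (I x - c).

(** For fixed [C], the energy of [U] is the supremum over test fields [phi] of its pairing with this
    weight. *)
Definition weight phi C : 'I_N -> R * R -> R :=
  fun i x => divergence (phi i) x + fidelity (C i) x.

Lemma fidelity_ge0 c x : 0 <= fidelity c x.
Proof. by apply: mulr_ge0; [exact: ltW|exact: nrm_ge0]. Qed.

Lemma fidelity_le c c' x : fidelity c x <= fidelity c' x + lambda * nrm (c -
  c').
Proof.
rewrite /fidelity -mulrDr ler_pM2l//.
by rewrite (nrm_distC nrm_norm c) -{1}(subrKA c' (I x)) nrmD.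
Qed.

Lemma dist_ae_bounded c : ae_bounded mu Omega (fun x => nrm (I x - c)).
Proof.
have [mI [M IM]] := I_Linfty; split.
  apply: (measurable_nrm nrm_norm) => j.
  rewrite (_ : (fun _ => _) = (fun x => I x 0 j - c 0 j)).
    by apply: measurable_funB.
  by apply/funext => x; rewrite !mxE.
exists (M + nrm c); apply: (@filterS _ _ (ae_filter_ringOfSetsType mu) _ _ _
  IM) => x {}IM Ox.
rewrite ger0_norm; last exact: nrm_ge0.
rewrite (le_trans (nrmD nrm_norm _ _))//.
by rewrite nrmN// lerD2r IM.
Qed.

Lemma fidelity_ae_bounded c : ae_bounded mu Omega (fidelity c).
Proof. by apply: ae_boundedM (dist_ae_bounded c); exact: ae_bounded_cst. Qed.

Lemma weight_ae_bounded phi C : (forall i, test_field Omega (phi i)) ->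
  forall i, ae_bounded mu Omega (weight phi C i).
Proof.
move=> tphi i; apply: ae_boundedD; last exact: fidelity_ae_bounded.
exact: divergence_ae_bounded.
Qed.

(** Each phase has its own test field, so [sum_ereal_sup_leP] moves the suprema outside the sum;
    linearity of the integral then assembles the weight. *)
Lemma energy_leP U C (e : R) : (forall i, ae_bounded mu Omega (U i)) ->
  (E U C <= e%:E)%E <-> forall phi, (forall i, test_field Omega (phi i)) ->
    pairing mu Omega U (weight phi C) <= e.
Proof.
move=> bU.
pose S i psi := \int[mu]_(x in Omega) (U i x * divergence psi x).
pose b i := lambda * \int[mu]_(x in Omega) (nrm (I x - C i) * U i x).
have bN i : ae_bounded mu Omega (fun x => nrm (I x - C i) * U i x).
  by apply: ae_boundedM => //; exact: dist_ae_bounded.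
have -> : E U C = (\sum_(i < N) (ereal_sup [set (S i psi)%:E | psi in
  test_field Omega]
    + (b i)%:E))%E.
  apply: eq_bigr => i _; congr (_ + _)%E; last first.
    by rewrite EFinM /Rintegral fineK//; apply: integrable_fin_num => //;
      exact: ae_bounded_integrable (bN i).
  congr ereal_sup; apply: eq_imagel => psi tpsi.
  rewrite /S /Rintegral fineK//; apply: integrable_fin_num => //.
  apply: ae_bounded_integrable => //; apply: ae_boundedM => //.
  exact: divergence_ae_bounded.
rewrite sum_ereal_sup_leP; last by exists (cst 0); exact: test_field0.
have pE phi : (forall i, test_field Omega (phi i)) ->
    pairing mu Omega U (weight phi C) = \sum_(i < N) (S i (phi i) + b i).
  move=> tphi; apply: eq_bigr => i _.
  have bd : ae_bounded mu Omega (fun x => U i x * divergence (phi i) x).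
    by apply: ae_boundedM => //; exact: divergence_ae_bounded.
  rewrite /b -RintegralZl//; last exact: ae_bounded_integrable (bN i).
  rewrite -RintegralD//; last 2 first.
  - exact: ae_bounded_integrable.
  - apply: ae_bounded_integrable => //.
    by apply: ae_boundedM => //; exact: ae_bounded_cst.
  by apply: eq_Rintegral => x _; rewrite /weight /fidelity mulrDr;
    congr (_ + _); rewrite mulrC mulrA.
by split => h phi tphi; have := h phi tphi; rewrite pE.
Qed.

Lemma fuzzy_memberships_memberships U : fuzzy_memberships Omega U ->
  memberships mu Omega U.
Proof.
move=> [bvU U0 U1]; split => // i; have [iU _] := bvU i.
by apply/measurable_EFinP; exact: (measurable_int mu iU).
Qed.

(** The zero field leaves only the nonnegative fidelity; this bounds the infimum of the energy from
    below. *)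
Lemma pairing_zero_ge0 U C : memberships mu Omega U ->
  0 <= pairing mu Omega U (weight (fun=> cst 0) C).
Proof.
move=> UM; apply: sumr_ge0 => i _.
have bU := memberships_bounded UM i.
have -> : 0 = \int[mu]_(x in Omega) 0 by rewrite Rintegral_cst// mul0r.
apply: ae_le_Rintegral => //; first exact: ae_bounded_cst.
  by apply: ae_boundedM => //; apply: weight_ae_bounded => j;
    exact: test_field0.
apply: filterS (memberships_le1 UM i) => x Ux Ox.
have /andP[U0 _] := Ux Ox.
by rewrite /weight divergence0 add0r mulr_ge0// fidelity_ge0.
Qed.

(** Testing with [psi] in phase [i] and the zero field in the others, then dropping the nonnegative
    fidelities, bounds each total variation by [e]. *)
Lemma memberships_fuzzy_memberships U C (e : R) : memberships mu Omega U ->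
  (E U C <= e%:E)%E -> fuzzy_memberships Omega U.
Proof.
move=> UM Ue; have [mU U0 U1] := UM; split => // i.
have bU := memberships_bounded UM.
split; first exact: ae_bounded_integrable (bU i).
apply: (@le_lt_trans _ _ e%:E); last exact: ltry.
apply: ge_ereal_sup => _ [psi tpsi <-].
have tpsi' j : test_field Omega (if j == i then psi else cst 0).
  by case: ifP => // _; exact: test_field0.
have bUw D j : test_field Omega D -> ae_bounded mu Omega (fun x =>
  U j x * divergence D x).
  by move=> tD; apply: ae_boundedM => //; exact: divergence_ae_bounded.
rewrite -[leLHS]fineK; last first.
  by apply: integrable_fin_num => //;
    exact: ae_bounded_integrable (bUw _ i tpsi).
rewrite lee_fin; apply: le_trans ((energy_leP C e bU).1 Ue _ tpsi').
rewrite /pairing (bigD1 i)//= -[leLHS]addr0; apply: lerD.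
  rewrite -[leLHS]/(\int[mu]_(x in Omega) (U i x * divergence psi x)).
  apply: ae_le_Rintegral => //; first exact: bUw.
    by apply: ae_boundedM => //; exact: weight_ae_bounded.
  apply: filterS (memberships_le1 UM i) => x Ux Ox; have /andP[Ui0 _] := Ux Ox.
  by rewrite ler_wpM2l// /weight eqxx lerDl fidelity_ge0.
apply: sumr_ge0 => j ji.
have -> : 0 = \int[mu]_(x in Omega) 0 by rewrite Rintegral_cst// mul0r.
apply: ae_le_Rintegral => //; first exact: ae_bounded_cst.
  by apply: ae_boundedM => //; exact: weight_ae_bounded.
apply: filterS (memberships_le1 UM j) => x Ux Ox; have /andP[Uj0 _] := Ux Ox.
by rewrite /weight (negbTE ji) divergence0 add0r mulr_ge0// fidelity_ge0.
Qed.

(** Minimality is tested on real upper bounds [r], which makes [m] a real number; a competitor of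
    infinite energy satisfies the condition vacuously. *)
Definition energy_min C U (m : R) := [/\ memberships mu Omega U, (E U C <=
  m%:E)%E
  & forall U' (r : R), memberships mu Omega U' -> (E U' C <= r%:E)%E -> m <= r].

Lemma energy_min_exists C : (0 < N)%N -> exists U m, energy_min C U m.
Proof.
move=> N0.
pose W := [set weight phi C | phi in [set phi | forall i, test_field Omega
  (phi i)]].
pose S := [set e : R | exists2 U, memberships mu Omega U & forall w, W w ->
  pairing mu Omega U w <= e].
have SP U e : memberships mu Omega U ->
    (forall w, W w -> pairing mu Omega U w <= e) <-> (E U C <= e%:E)%E.
  move=> UM; rewrite energy_leP; last exact: memberships_bounded.
  split=> [h phi tphi|h _ [phi tphi <-]]; last exact: h.
  by apply: h; exists phi.
have bW w : W w -> forall i, ae_bounded mu Omega (w i).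
  by move=> [phi tphi <-]; exact: weight_ae_bounded.
have hS : has_inf S.
  split.
    (* For the constant membership $1/N$ the divergence terms integrate to 0, so its energy is
       bounded by its fidelity alone. *)
    pose U0 : 'I_N -> R * R -> R := fun _ _ => N%:R^-1.
    have UM0 : memberships mu Omega U0.
      split=> [i|i|]; first exact: measurable_cst.
        by apply: aeW => x _; rewrite /U0 invr_ge0.
      apply: aeW => x _; rewrite sumr_const card_ord -[LHS]mulr_natr mulVf//.
      by rewrite pnatr_eq0 -lt0n.
    exists (\sum_(i < N) N%:R^-1 * \int[mu]_(x in Omega) fidelity (C i) x), U0
      => //.
    move=> _ [phi tphi <-]; apply: ler_sum => i _.
    have bw := weight_ae_bounded C tphi i.
    rewrite RintegralZl//; last exact: ae_bounded_integrable bw.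
    rewrite ler_pM2l ?invr_gt0 ?ltr0n//.
    rewrite RintegralD//; last 2 first.
    - by apply: ae_bounded_integrable => //; exact: divergence_ae_bounded.
    - by apply: ae_bounded_integrable => //; exact: fidelity_ae_bounded.
    by rewrite Rintegral_divergence// add0r.
  exists 0 => e [U UM Ue]; apply: le_trans (pairing_zero_ge0 C UM) (Ue _ _).
  by exists (fun=> cst 0) => // i; exact: test_field0.
have [U UM Um] := pairing_minimizer mO muO bW hS.
exists U, (inf S); split => //; first exact/SP.
move=> U' r UM' /(SP _ _ UM') U'r; apply: ge_inf; first by case: hS.
by exists U'.
Qed.

Lemma energy_min_le C U m (U' : 'I_N -> R * R -> R) : energy_min C U m ->
  memberships mu Omega U' -> (m%:E <= E U' C)%E.
Proof.
move=> [_ _ mP] UM'; case EE : (E U' C) => [r||]; last 2 first.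
- exact: leey.
(* An energy of [-oo] would lie below [m - 1] and force [m <= m - 1]. *)
- have : (E U' C <= (m - 1)%R%:E)%E by rewrite EE leNye.
  by move=> /(mP _ _ UM') {EE} ?; exfalso; lra.
by rewrite lee_fin; apply: mP UM' _; rewrite EE.
Qed.

(** The minimizer for [C] is a competitor for [C']. The lemma serves both the Lipschitz bound in [C]
    and, with [c] equal to 0, the truncation of large [c_i]. *)
Lemma energy_min_transfer C C' U m U' m' (c : 'I_N -> R) :
  energy_min C U m -> energy_min C' U' m' -> (forall i, 0 <= c i) ->
  (forall i, {ae mu, forall x, Omega x -> fidelity (C' i) x <= fidelity (C i)
    x + c i}) ->
  m' <= m + fine (mu Omega) * \sum_(i < N) c i.
Proof.
move=> [UM Um _] [_ _ m'P] c0 fc; apply: (m'P U) => //.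
have bU := memberships_bounded UM.
apply/energy_leP => // phi tphi.
apply: (@le_trans _ _ (pairing mu Omega U (weight phi C) + fine (mu Omega) *
  \sum_(i < N) c i)).
  apply: pairing_le => //; do ?exact: weight_ae_bounded.
  move=> i; apply: (@filterS _ _ (ae_filter_ringOfSetsType mu) _ _ _ (fc i))
    => x h /h fx.
  by rewrite /weight -[leRHS]addrA lerD2l.
by rewrite lerD2r; apply: (energy_leP C m bU).1.
Qed.

Lemma exists_energy_minimizer : (0 < N)%N ->
  exists U C, fuzzy_memberships Omega U /\ forall U' C',
    fuzzy_memberships Omega U' -> (E U C <= E U' C')%E.
Proof.
move=> N0; have [_ [M0 IM0]] := I_Linfty.
(* The bound [M0] may be negative when [Omega] is empty. *)
pose M := Num.max 0 M0.
have M_ge0 : 0 <= M by rewrite le_max lexx.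
have IM : {ae mu, forall x, Omega x -> nrm (I x) <= M}.
  apply: (@filterS _ _ (ae_filter_ringOfSetsType mu) _ _ _ IM0) => x h Ox.
  by rewrite /M le_max h ?orbT.
have /choice[mU mUP] C : exists Um : ('I_N -> R * R -> R) * R, energy_min C
  Um.1 Um.2.
  by have [U [m UmP]] := energy_min_exists C N0; exists (U, m).
pose f (v : 'rV['rV[R]_s]_N) : R := (mU (fun i => v 0 i)).2.
have f_lip v w : f w <= f v + fine (mu Omega) * \sum_(i < N) lambda * nrm (w 0
  i - v 0 i).
  apply: (energy_min_transfer (mUP _) (mUP _)) => i.
    by apply: mulr_ge0; [exact: ltW|exact: nrm_ge0].
  by apply: aeW => x _; exact: fidelity_le.
pose A := [set v : 'rV['rV[R]_s]_N | forall i, [set c | nrm c <= 2 * M] (v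
  ord0 i)].
have cA : compact A.
  apply: (@rV_compact 'rV[R]_s N (fun=> [set c | nrm c <= 2 * M])) => i.
  exact: nrm_ball_compact.
have A0 : A !=set0.
  by exists (\row_i 0) => i /=; rewrite mxE nrm0// mulr_ge0.
have cf : continuous f.
  move=> v; apply/(@cvgrPdist_le _ _ _ (nbhs v)) => e e0.
  pose K := fine (mu Omega) * (lambda *+ N).
  have K0 : 0 <= K by rewrite mulr_ge0 ?fine_ge0// mulrn_wge0// ltW.
  (* The Lipschitz constant [K] can be 0, hence the denominator [K + 1]. *)
  have d0 : 0 < e / (K + 1) by rewrite divr_gt0// ltr_wpDl.
  have : K * (e / (K + 1)) <= e.
    rewrite mulrCA; apply: ler_piMr; first exact: ltW.
    by rewrite ler_pdivrMr ?ltr_wpDl// mul1r lerDl.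
  move: (e / (K + 1)) d0 => d d0 Kd.
  (* A neighbourhood of a matrix is given by a family of neighbourhoods of its entries. *)
  exists (fun _ i => [set c | nrm (c - v 0 i) < d]) => [i0 i|w vw].
    have : (fun c => nrm (c - v i0 i)) @ nbhs (v i0 i) --> nrm (v i0 i - v i0
      i).
      apply: (@cvg_comp _ _ _ (fun c =>
        c - v i0 i) nrm (nbhs (v i0 i)) (nbhs (v i0 i - v i0 i))).
        by apply: cvgB; [exact: cvg_id|exact: cvg_cst].
      exact: nrm_continuous.
    rewrite subrr nrm0// (ord1 i0) => /cvgr_lt; exact.
  have vw' : fine (mu Omega) * (\sum_(i < N) lambda * nrm (w 0 i - v 0 i)) <= e.
    apply: le_trans Kd; rewrite /K -mulrA ler_wpM2l ?fine_ge0//.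
    rewrite -[in leRHS](card_ord N) -sumr_const mulr_suml.
    by apply: ler_sum => i _; rewrite ler_pM2l// ltW//; exact: (vw ord0 i).
  have := f_lip v w; have := f_lip w v.
  under eq_bigr do rewrite nrm_distC//.
  by move=> h1 h2; rewrite /= ler_norml; apply/andP; split; lra.
have [v /[!inE] Av vmin] := compact_EVT_min A0 cA (continuous_subspaceT cf).
pose C i := v 0 i.
exists (mU C).1, C; have [UM Um _] := mUP C.
split; first exact: memberships_fuzzy_memberships UM Um.
move=> U' C' fU'; have UM' := fuzzy_memberships_memberships fU'.
apply: le_trans (energy_min_le (mUP C') UM').
apply: le_trans Um _; rewrite lee_fin.
(* If [nrm (C' i) > 2 * M], then [nrm (I x) <= M < nrm (C' i) - M <= nrm (I x - C' i)] almost
   everywhere on [Omega], so 0 is at least as good as [C' i]. *)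
pose w : 'rV['rV[R]_s]_N := \row_i (if nrm (C' i) <= 2 * M then C' i else 0).
have Aw : A w.
  by move=> i /=; rewrite mxE; case: ifP => // _; rewrite nrm0// mulr_ge0.
apply: (@le_trans _ _ (f w)); first by apply: vmin; rewrite inE.
rewrite -[leRHS]addr0 -(mulr0 (fine (mu Omega))).
rewrite -[X in _ + _ * X](_ : \sum_(i < N) 0 = 0); last by rewrite big1.
apply: (energy_min_transfer (mUP C') (mUP _)) => // i.
apply: (@filterS _ _ (ae_filter_ringOfSetsType mu) _ _ _ IM) => x h Ox.
rewrite addr0 mxE; case: ifPn => //; rewrite -ltNge => C'M.
rewrite /fidelity subr0 ler_pM2l//.
have := nrmD nrm_norm (I x) (C' i - I x);
  rewrite (nrm_distC nrm_norm (C' i)) subrKC.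
by have := h Ox; lra.
Qed.

End existence.

Theorem theorem1 (R : realType) (Omega : set (R * R))
    (Omega_open : open Omega) (Omega_bounded : bounded_set Omega)
    (Omega_lipschitz : lipschitz_boundary Omega)
    (N : nat) (N_ge1 : (1 <= N)%N)
    (s : nat) (s13 : s = 1%N \/ s = 3%N)
    (nrm : 'rV[R]_s -> R) (nrm_norm : is_norm nrm)
    (nrm1 : s = 1%N -> forall (v : 'rV[R]_s) (j : 'I_s), nrm v = `|v 0 j|)
    (I : R * R -> 'rV[R]_s) (I_Linfty : Linfty Omega nrm I)
    (lambda : R) (lambda_gt0 : 0 < lambda) :
  exists (U : 'I_N -> R * R -> R) (C : 'I_N -> 'rV[R]_s),
    fuzzy_memberships Omega U /\
    forall (U' : 'I_N -> R * R -> R) (C' : 'I_N -> 'rV[R]_s),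
      fuzzy_memberships Omega U' ->
      (energy Omega nrm I lambda U C <= energy Omega nrm I lambda U' C')%E.
Proof.
by have [U [C UC]] := exists_energy_minimizer Omega_open Omega_bounded nrm_norm
  I_Linfty lambda_gt0 N_ge1; exists U, C.
Qed.
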